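(* Let $X$ and $Y$ be nonempty finite ultrametric spaces, with representing trees $T_X$, $T_Y$, and let $\overline{T}_X$, $\overline{T}_Y$ be the rooted trees obtained from $T_X$, $T_Y$ by erasing all labels. Then $\overline{T}_X$ and $\overline{T}_Y$ are isomorphic as rooted trees if and only if there exists a ball-preserving bijective mapping $\Phi: X\to Y$.
   Context: An ultrametric space is a metric space $(X,d)$ with $d(x,y)\le\max\{d(x,z),d(z,y)\}$ for all $x,y,z\in X$; all spaces are assumed nonempty. $\mathrm{diam}\,X=\sup\{d(x,y):x,y\in X\}$. Balls. For a metric space $(X,d)$, $t\in X$ and $r\ge 0$, let $B_r(t)=\{x\in X: d(x,t)\le r\}$, and let $\mathrm{Sp}_t(X)=\{d(x,t):x\in X\}$. Define $\mathbf{B}_X=\{B_r(t): t\in X,\ r\in \mathrm{Sp}_t(X)\}$. A mapping $F:X\to Y$ between metric spaces is ball-preserving if $F(Z)\in\mathbf{B}_Y$ for every $Z\in\mathbf{B}_X$ and $F^{-1}(W)\in\mathbf{B}_X$ for every $W\in\mathbf{B}_Y$ (image and preimage of sets). Diametrical graph. For a finite ultrametric space $(X,d)$ with $|X|\ge2$, the diametrical graph $G_d$ has vertex set $X$, and $\{u,v\}$ is an edge iff $d(u,v)=\mathrm{diam}\,X$. It is known that $G_d$ is complete $k$-partite with some $k\ge 2$ nonempty parts $X_1,\dots,X_k$ (no edges inside a part, all edges between different parts). Representing tree. The labeled rooted tree $T_X$ of a nonempty finite ultrametric space $(X,d)$ is defined recursively. If $X=\{x\}$, then $T_X$ is the single node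 (root) labeled $x$. If $|X|\ge 2$, the root is labeled $\mathrm{diam}\,X$, and its children $v_1,\dots,v_k$ correspond to the parts $X_1,\dots,X_k$ of the diametrical graph of $X$; the subtree hanging at $v_i$ is the representing tree of $(X_i,d|_{X_i\times X_i})$. Thus $v_i$ is a leaf labeled $x$ if $X_i=\{x\}$, and an internal node labeled $\mathrm{diam}\,X_i$ if $|X_i|\ge2$. The leaves of $T_X$ are in bijection with the points of $X$ via their labels. Two rooted trees are isomorphic if there is a bijection between their vertex sets that maps root to root and preserves adjacency in both directions. *)

(* Defs.v *)
From HB Require Import structures.
From mathcomp Require Import all_boot all_order all_algebra.
From mathcomp Require Import all_classical reals topology metric_structure.
(* Last, so that the set0, partition, ... of finite sets take precedence. *)
From mathcomp Require Import finset.

Set Implicit Arguments.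
Unset Strict Implicit.
Unset Printing Implicit Defensive.

Import Order.TTheory GRing.Theory Num.Theory.

Local Open Scope ring_scope.

HB.mixin Record Metric_isUltrametric (R : realType) X & Metric R X := {
  mdist_ultra : forall x y z : X,
    mdist x y <= Num.max (mdist x z) (mdist z y)
}.

#[short(type="finUltrametricType")]
HB.structure Definition FinUltrametric (R : realType) :=
  {X of Finite X & Metric R X & Metric_isUltrametric R X}.

Section MetricSpaces.
Local Open Scope classical_set_scope.
Context {R : realType}.

Definition diam (X : metricType R) (A : set X) : R :=
  sup [set mdist x y | x in A & y in A].

Definition spectrum (X : metricType R) (t : X) : set R :=
  range (fun x => mdist x t).

(* The library's [closed_ball] is the closure of an open ball, which in an
   ultrametric space is in general not the set below. *)
Definition cball (X : metricType R) (t : X) (r : R) : set X :=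
  [set x | mdist x t <= r].

Definition balls (X : metricType R) : set (set X) :=
  [set Z | exists t r, spectrum t r /\ Z = cball t r].
Arguments balls : clear implicits.

Definition ball_preserving (X Y : metricType R) (F : X -> Y) : Prop :=
  (forall Z, balls X Z -> balls Y (F @` Z)) /\
  (forall W, balls Y W -> balls X (F @^-1` W)).

End MetricSpaces.

Arguments balls {R} X _.

Section RootedTrees.
Local Open Scope nat_scope.

(* Children come as a sequence; their order is forgotten by [tree_iso]. *)
Inductive tree (L : Type) : Type := Node of L & seq (tree L).

Definition children L (t : tree L) : seq (tree L) := let: Node _ ts := t in ts.

Fixpoint erase L (t : tree L) : tree unit :=
  let: Node _ ts := t in Node tt [seq erase u | u <- ts].

(* A vertex of a tree is the sequence of child indices that leads to it from
   the root. *)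
Fixpoint subtree L (t : tree L) (p : seq nat) : option (tree L) :=
  if p is i :: p' then
    if onth (children t) i is Some u then subtree u p' else None
  else Some t.

Definition vertex L (t : tree L) : Type := {p : seq nat | isSome (subtree t p)}.

Definition root L (t : tree L) : vertex t := exist _ [::] isT.

Definition is_child L (t : tree L) (u v : vertex t) : Prop :=
  exists i, sval v = rcons (sval u) i.

Definition adjacent L (t : tree L) (u v : vertex t) : Prop :=
  is_child u v \/ is_child v u.

Definition tree_iso (t1 t2 : tree unit) : Prop :=
  exists f : vertex t1 -> vertex t2,
    [/\ bijective f, f (root t1) = root t2 &
        forall u v, adjacent u v <-> adjacent (f u) (f v)].

End RootedTrees.

Definition complete_multipartite (T : finType) (A : {set T}) (e : rel T)
    (P : {set {set T}}) : bool :=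
  [&& partition P A, (2 <= #|P|)%N &
      [forall B in P, forall C in P, forall u in B, forall v in C,
         e u v == (B != C)]].

Section RepresentingTree.
Context {R : realType} (X : finUltrametricType R).
Implicit Types (A : {set X}) (P : {set {set X}}).

Definition diam_edge A : rel X :=
  fun u v => [&& u \in A, v \in A & mdist u v == diam [set` A]].

(* The parts of the diametrical graph on A; by [diam_partsP] and
   [diam_parts_unique] they exist and are unique as soon as A has two points. *)
Definition diam_parts A : {set {set X}} :=
  odflt set0 [pick P | complete_multipartite A (diam_edge A) P].

(* The subspaces met in the recursion are represented as subsets of X. Parts
   are proper subsets, so #|A| is enough fuel: see [repr_tree_node]. *)
Fixpoint repr_tree_rec (n : nat) A : tree (X + R) :=
  if [pick x | A == [set x]] is Some x then Node (inl x) [::]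
  else Node (inr (diam [set` A]))
         (if n is n'.+1 then [seq repr_tree_rec n' B | B <- enum (diam_parts A)]
          else [::]).

Definition repr_tree A : tree (X + R) := repr_tree_rec #|A| A.

Lemma diam_ub A x y : x \in A -> y \in A -> mdist x y <= diam [set` A].
Proof.
move=> xA yA; apply: ub_le_sup; last by exists x => //; exists y.
exists (\sum_(p : X * X) mdist p.1 p.2) => _ [u _ [v _ <-]].
rewrite (bigD1 (u, v)) //= lerDl.
by apply: sumr_ge0 => p _; apply: mdist_ge0.
Qed.

Lemma diam_attained A : A != set0 ->
  exists x y, [/\ x \in A, y \in A & mdist x y = diam [set` A]].
Proof.
case/set0Pn => a aA.
have aa : ((a, a) \in setX A A) by rewrite inE aA.
case: (@Order.TotalTheory.arg_maxP _ _ _ (a, a) (fun p => p \in setX A A)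
         (fun p => mdist p.1 p.2) aa) => -[x y] /= xyA max_xy.
move: xyA; rewrite inE /= => /andP[xA yA].
exists x, y; split=> //; apply/eqP; rewrite eq_le diam_ub //=.
apply: ge_sup; first by exists (mdist a a); exists a => //; exists a.
move=> _ [u uA [v vA <-]].
by apply: (max_xy (u, v)); rewrite inE; apply/andP.
Qed.

Lemma complete_multipartiteE A (e : rel X) P : complete_multipartite A e P ->
  P = [set [set y in A | ~~ e x y] | x in A].
Proof.
case/and3P=> partP _ /forall_inP eP.
have /and3P[/eqP covP tivP P0] := partP.
have blk B x : B \in P -> x \in B -> [set y in A | ~~ e x y] = B.
  move=> BP xB; apply/setP=> y; rewrite inE -covP.
  apply/andP/idP => [[/bigcupP[C CP yC]]|yB].
    move/forall_inP: (eP _ BP) => /(_ _ CP) /forall_inP /(_ _ xB).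
    by move=> /forall_inP /(_ _ yC) /eqP ->; rewrite negbK => /eqP ->.
  split; first by apply/bigcupP; exists B.
  move/forall_inP: (eP _ BP) => /(_ _ BP) /forall_inP /(_ _ xB).
  by move=> /forall_inP /(_ _ yB) /eqP ->; rewrite eqxx.
apply/setP=> B; apply/idP/imsetP => [BP|[x]].
  have /set0Pn[x xB] : B != set0 by apply: contraNneq P0 => <-.
  exists x; last by rewrite (blk B).
  by rewrite -covP; apply/bigcupP; exists B.
by rewrite -{1}covP => /bigcupP[C CP xC] ->; rewrite (blk C).
Qed.

Lemma diam_parts_exist A : (2 <= #|A|)%N ->
  exists P, complete_multipartite A (diam_edge A) P.
Proof.
move=> A2; have /card_gt1P[a [b [aA bA ab]]] := A2.
have diam_gt0 : 0 < diam [set` A].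
  by apply: lt_le_trans (diam_ub aA bA); rewrite mdist_gt0.
pose r : rel X := fun u v => ~~ diam_edge A u v.
have rE u v : u \in A -> v \in A -> r u v = (mdist u v < diam [set` A]).
  by move=> uA vA; rewrite /r /diam_edge uA vA /= lt_neqAle diam_ub // andbT.
have eqr : {in A & &, equivalence_rel r}.
  move=> x y z xA yA zA; split; first by rewrite rE // mdistxx.
  rewrite !rE // => xy; apply/idP/idP => h.
    apply: le_lt_trans (mdist_ultra y z x) _.
    by rewrite gt_max h metric_sym xy.
  by apply: le_lt_trans (mdist_ultra x z y) _; rewrite gt_max h xy.
pose P := equivalence_partition r A.
have partP : partition P A by apply: equivalence_partitionP.
have inP u v : u \in A -> v \in A -> (v \in pblock P u) = r u v.
  by move=> uA vA; rewrite pblock_equivalence_partition.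
have /and3P[/eqP covP tivP P0] := partP.
have blkE B u : B \in P -> u \in B -> pblock P u = B.
  by move=> BP uB; apply: def_pblock.
have sub B u : B \in P -> u \in B -> u \in A.
  by move=> BP uB; rewrite -covP; apply/bigcupP; exists B.
exists P; apply/and3P; split=> //.
  have /diam_attained[x [y [xA yA xy]]] : A != set0 by apply/set0Pn; exists a.
  apply/card_gt1P; exists (pblock P x), (pblock P y).
  split; [by rewrite pblock_mem ?covP | by rewrite pblock_mem ?covP |].
  by rewrite eq_pblock ?covP // inP // rE // xy ltxx.
apply/forall_inP=> B BP; apply/forall_inP=> C CP.
apply/forall_inP=> u uB; apply/forall_inP=> v vC; apply/eqP.
have uA := sub _ _ BP uB; have vA := sub _ _ CP vC.
by rewrite -(blkE B u) // -(blkE C v) // eq_pblock ?covP // inP // negbK.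
Qed.

Lemma diam_partsP A : (2 <= #|A|)%N ->
  complete_multipartite A (diam_edge A) (diam_parts A).
Proof.
move=> /diam_parts_exist[P cP]; rewrite /diam_parts.
by case: pickP => [//|/(_ P)]; rewrite cP.
Qed.

Lemma diam_parts_unique A P : complete_multipartite A (diam_edge A) P ->
  P = diam_parts A.
Proof.
move=> cP; rewrite /diam_parts; case: pickP => [Q cQ|/(_ P)]; last by rewrite cP.
by rewrite (complete_multipartiteE cP) (complete_multipartiteE cQ).
Qed.

Lemma diam_part_proper A B : (2 <= #|A|)%N -> B \in diam_parts A -> B \proper A.
Proof.
move=> /diam_partsP /and3P[partP /card_gt1P[C [D [CP DP CD]]] _] BP.
have /and3P[/eqP covP tivP P0] := partP.
have [E EP EB] : exists2 E, E \in diam_parts A & E != B.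
  by case: (eqVneq C B) CD => [-> CD|CB _]; [exists D; rewrite // eq_sym | exists C].
have /set0Pn[x xE] : E != set0 by apply: contraNneq P0 => <-.
apply/properP; split.
  by rewrite -covP; apply/fintype.subsetP=> y yB; apply/bigcupP; exists B.
exists x; first by rewrite -covP; apply/bigcupP; exists E.
have /trivIsetP/(_ _ _ EP BP EB) := tivP.
by rewrite disjoint_subset => /fintype.subsetP/(_ _ xE).
Qed.

Lemma repr_tree_leaf x : repr_tree [set x] = Node (inl x) [::].
Proof.
rewrite /repr_tree cards1 /=.
by case: pickP => [y /eqP/set1_inj -> //|/(_ x)]; rewrite eqxx.
Qed.

Lemma repr_tree_node A : (2 <= #|A|)%N ->
  repr_tree A = Node (inr (diam [set` A])) [seq repr_tree B | B <- enum (diam_parts A)].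
Proof.
have pick2 (B : {set X}) : (2 <= #|B|)%N -> [pick x | B == [set x]] = None.
  by move=> B2; case: pickP => // x /eqP Bx; rewrite Bx cards1 in B2.
suff recE n (B : {set X}) : (0 < #|B| <= n)%N -> repr_tree_rec n B = repr_tree B.
  move=> A2; rewrite {1}/repr_tree; case cA: #|A| => [|n]; first by rewrite cA in A2.
  rewrite /= pick2 //; congr Node; apply/eq_in_map => B; rewrite mem_enum => BP.
  apply: recE; have /and3P[/and3P[_ _ P0] _ _] := diam_partsP A2.
  have := proper_card (diam_part_proper A2 BP); rewrite cA ltnS => ->.
  by rewrite andbT card_gt0; apply: contraNneq P0 => <-.
elim/ltn_ind: n B => n IH B /andP[B0 Bn].
case: (leqP #|B| 1) => [B1|B2].
  have /cards1P[x ->] : #|B| == 1%N by rewrite eqn_leq B1.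
  rewrite repr_tree_leaf; case: n {IH Bn} => [|n] /=;
  by case: pickP => [y /eqP/set1_inj -> //|/(_ x)]; rewrite eqxx.
rewrite /repr_tree; case cB: #|B| => [|m]; first by rewrite cB in B0.
case: n IH Bn => [|n] IH; rewrite cB //= pick2 // => mn.
congr Node; apply/eq_in_map => C; rewrite mem_enum => CP.
have /and3P[/and3P[_ _ P0] _ _] := diam_partsP B2.
have C0 : (0 < #|C|)%N by rewrite card_gt0; apply: contraNneq P0 => <-.
have Cm : (#|C| <= m)%N.
  by have := proper_card (diam_part_proper B2 CP); rewrite cB ltnS.
rewrite (IH n) ?C0 ?(leq_trans Cm) // (IH m) ?C0 //.
Qed.

End RepresentingTree.

(* Main.v *)
Require Import Defs.
From HB Require Import structures.
From mathcomp Require Import all_boot all_order all_algebra.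
From mathcomp Require Import all_classical reals topology metric_structure.
From mathcomp Require Import finset.

(** Vertices of a representing tree, ordered by the prefix relation on paths,
    correspond to the balls of the space, ordered by reverse inclusion: the
    parts of the diametrical graph of a ball are its maximal proper subballs.
    A rooted tree isomorphism is the same as an isomorphism of prefix orders.
    Hence isomorphic trees mean isomorphic posets of balls, and such a poset
    isomorphism is induced by a bijection of points, since the points are the
    minimal balls. *)

Set Implicit Arguments.
Unset Strict Implicit.
Unset Printing Implicit Defensive.

Import Order.TTheory GRing.Theory Num.Theory.

(** * Rooted tree isomorphisms as isomorphisms of prefix orders *)

Section TreeIsoPrefix.
Variable L : Type.
Implicit Type t : tree L.

Lemma subtree_cat t p q :
  subtree t (p ++ q) = obind (fun u => subtree u q) (subtree t p).
Proof. by elim: p t => //= i p IH t; case: onth. Qed.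

Lemma vertex_prefix t (v : vertex t) p :
  prefix p (sval v) -> exists u : vertex t, sval u = p.
Proof.
case: v => q /= vq /prefixP[r qE].
have pv : subtree t p by move: vq; rewrite qE subtree_cat; case: subtree.
by exists (exist _ p pv).
Qed.

Lemma prefix_antisym (T : eqType) (p q : seq T) :
  prefix p q -> prefix q p -> p = q.
Proof.
move=> pq qp; have eqs : size p = size q.
  by apply/eqP; rewrite eqn_leq !size_prefix.
by move: pq; rewrite prefixE eqs take_size => /eqP.
Qed.

Lemma prefix_rconsE (T : eqType) (p q : seq T) x :
  prefix p (rcons q x) = (p == rcons q x) || prefix p q.
Proof.
apply/idP/orP => [/prefixP[r]|[/eqP->|/prefix_trans]].
- case/lastP: r => [|r y].
    by rewrite cats0 => ->; left.
  by rewrite -rcons_cat => /rcons_inj[-> _]; right; apply: prefix_prefix.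
- exact: prefix_refl.
- by apply; apply: prefix_rcons.
Qed.

(** Children are the covers of the prefix order, so any order isomorphism respects them. Since
    vertices are closed under prefixes, a longer extension of [u] would leave a vertex strictly in
    between. *)
Lemma is_childP t (u v : vertex t) :
  is_child u v <->
  [/\ prefix (sval u) (sval v), u <> v &
      forall w : vertex t, prefix (sval u) (sval w) ->
        prefix (sval w) (sval v) -> w = u \/ w = v].
Proof.
split=> [[i vE]|[/prefixP[r vE] uv between]].
  split=> [|uv|w uw].
  - by rewrite vE prefix_rcons.
  - by have := congr1 size vE; rewrite uv size_rcons => /n_Sn.
  - rewrite vE prefix_rconsE => /orP[/eqP wE|wu].
      by right; apply: val_inj; rewrite /= wE vE.
    by left; apply: val_inj; apply: prefix_antisym.
case: r vE => [|i r] vE.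
  by case: uv; apply: val_inj; rewrite /= vE cats0.
have pv : prefix (rcons (sval u) i) (sval v).
  by rewrite vE -cat_rcons prefix_prefix.
have [w wE] := vertex_prefix pv.
have [||wu|wv] := between w; rewrite ?wE ?prefix_rcons //.
  by have := congr1 size wE; rewrite wu size_rcons => /n_Sn.
by exists i; rewrite -wE wv.
Qed.

End TreeIsoPrefix.

(** Induction on the depth of [u]. If [f v] were the parent of [f u], then [f u] would not be the
    root and [u] would have a parent [w]. By induction [f w] is that same parent, so [v = w] by
    injectivity, yet [w] is no child of [u]. *)
Lemma adjacency_hom_child (t1 t2 : tree unit) (f : vertex t1 -> vertex t2) :
  injective f -> f (Defs.root t1) = Defs.root t2 ->
  (forall u v, adjacent u v -> adjacent (f u) (f v)) ->
  forall u v, is_child u v -> is_child (f u) (f v).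
Proof.
move=> f_inj f_root f_adj u.
have [n] := ubnP (size (sval u)); elim: n u => // n IH u un v uv.
have [//|[i fuE]] := f_adj u v (or_introl uv).
case uE : (sval u) / (lastP (sval u)) => [|p j].
  have uroot : u = Defs.root t1 by apply: val_inj; rewrite /= uE.
  by move: fuE; rewrite uroot f_root /=; case: (sval (f v)).
have [w wE] : exists w : vertex t1, sval w = p.
  by apply: (@vertex_prefix _ _ u); rewrite uE prefix_rcons.
have wu : is_child w u by exists j; rewrite wE.
have [|k fuE'] := IH w _ u wu.
  by move: un; rewrite uE size_rcons wE.
have fvw : f v = f w.
  by apply: val_inj => /=; move: fuE; rewrite fuE' => /rcons_inj[].
have vw := f_inj _ _ fvw.
case: uv => l; rewrite vw uE wE => /(congr1 size).
by rewrite !size_rcons => /eqP; rewrite -addn2 -{1}(addn0 (size p)) eqn_add2l.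
Qed.

Lemma child_hom_prefix (t1 t2 : tree unit) (f : vertex t1 -> vertex t2) :
  (forall u v, is_child u v -> is_child (f u) (f v)) ->
  forall u v, prefix (sval u) (sval v) -> prefix (sval (f u)) (sval (f v)).
Proof.
move=> f_child u v /prefixP[r]; elim/last_ind: r v => [|r i IH] v vE.
  suff -> : v = u by apply: prefix_refl.
  by apply: val_inj; rewrite /= vE cats0.
have [w wE] : exists w : vertex t1, sval w = sval u ++ r.
  by apply: (@vertex_prefix _ _ v); rewrite vE -rcons_cat prefix_rcons.
apply: prefix_trans (IH w wE) _.
have /f_child[k ->] : is_child w v by exists i; rewrite wE vE rcons_cat.
exact: prefix_rcons.
Qed.

Lemma tree_isoP (t1 t2 : tree unit) :
  tree_iso t1 t2 <->
  exists f : vertex t1 -> vertex t2, bijective f /\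
    forall u v, prefix (sval (f u)) (sval (f v)) = prefix (sval u) (sval v).
Proof.
split=> [[f [[g fK gK] f_root f_adj]]|[f [[g fK gK] f_pre]]].
  exists f; split; first by exists g.
  have f_hom := child_hom_prefix (adjacency_hom_child (can_inj fK) f_root
    (fun u v => (f_adj u v).1)).
  have g_root : g (Defs.root t2) = Defs.root t1 by rewrite -f_root fK.
  have g_adj u v : adjacent u v -> adjacent (g u) (g v).
    by move=> uv; apply/f_adj; rewrite !gK.
  have g_hom := child_hom_prefix (adjacency_hom_child (can_inj gK) g_root g_adj).
  move=> u v; apply/idP/idP; last exact: f_hom.
  by move=> /g_hom; rewrite !fK.
have f_child u v : is_child (f u) (f v) <-> is_child u v.
  rewrite !is_childP f_pre; split=> -[uv neq between]; split=> //.
  - by move=> uvE; apply: neq; rewrite uvE.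
  - move=> w uw wv; have := between (f w); rewrite !f_pre => /(_ uw wv).
    by case=> /(can_inj fK); [left | right].
  - by move/(can_inj fK).
  - move=> w; rewrite -(gK w) !f_pre => uw wv.
    by have [] := between _ uw wv => ->; [left | right].
exists f; split; first by exists g.
(* The root is the least vertex, so its image is a prefix of every [f (g _)], in particular of the
   root of [t2]. *)
- apply: val_inj => /=; apply/eqP; rewrite -prefixs0.
  by rewrite -[[::]]/(sval (Defs.root t2)) -(gK (Defs.root t2)) f_pre prefix0s.
- by move=> u v; rewrite /adjacent !f_child.
Qed.

(** * Balls of a finite ultrametric space as finite sets *)

Section Balls.
Local Open Scope ring_scope.
Context {R : realType} {X : finUltrametricType R}.
Implicit Types A B C : {set X}.

(* A center-free description of the balls: every point of an ultrametric ball
   is a center, and its radius is the largest distance from that center. *)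
Definition is_ball A : bool :=
  (A != set0) && [forall x in A, forall z in A, forall y,
    (mdist x y <= mdist x z) ==> (y \in A)].

Lemma is_ballP A :
  reflect (A != set0 /\ forall x y z, x \in A -> z \in A ->
             mdist x y <= mdist x z -> y \in A) (is_ball A).
Proof.
apply: (iffP andP) => -[A0 h]; split=> //.
  move=> x y z xA zA xy; move/forall_inP: h => /(_ _ xA) /forall_inP /(_ _ zA).
  by move=> /forallP /(_ y) /implyP /(_ xy).
apply/forall_inP=> x xA; apply/forall_inP=> z zA; apply/forallP=> y.
by apply/implyP; apply: h.
Qed.

Lemma ballsP A : balls X [set` A]%classic <-> is_ball A.
Proof.
split.
  case=> t [_ [[s _ <-] AE]].
  have inA x : (x \in A) = (mdist x t <= mdist s t).
    have AxE : is_true (x \in A) = (mdist x t <= mdist s t).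
      by have := congr1 (fun W => W x) AE.
    by apply/idP/idP; rewrite AxE.
  apply/is_ballP; split.
    by apply/set0Pn; exists t; rewrite inA mdistxx mdist_ge0.
  move=> x y z; rewrite !inA => xA zA xy.
  (* Both [x] and [z] lie within [mdist s t] of [t], which bounds [mdist x z], hence [mdist x y],
     hence [mdist y t]. *)
  apply: le_trans (mdist_ultra y t x) _; rewrite ge_max xA andbT metric_sym.
  apply: le_trans xy _; apply: le_trans (mdist_ultra x z t) _.
  by rewrite ge_max xA metric_sym.
case/is_ballP=> /set0Pn[t tA] h.
have [s sA max_s] := @Order.TotalTheory.arg_maxP _ _ _ t (mem A)
  (fun x => mdist x t) tA.
exists t, (mdist s t); split; first by exists s.
apply/seteqP; split=> x /=; first exact: max_s.
by move=> xs; apply: (h t x s) => //; rewrite metric_sym (metric_sym t).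
Qed.

Lemma is_ball_set1 x : is_ball [set x].
Proof.
apply/is_ballP; split=> [|a b c]; first by apply/set0Pn; exists x; rewrite set11.
by rewrite !inE => /eqP-> /eqP->; rewrite mdistxx leNgt mdist_gt0 negbK eq_sym.
Qed.

Lemma is_ballT : (0 < #|X|)%N -> is_ball [set: X].
Proof.
by move=> X0; apply/is_ballP; split=> [|x y z _ _ _]; rewrite ?inE // -card_gt0 cardsT.
Qed.

(** * Diametrical parts as the maximal proper subballs *)

Lemma diam_parts_gt1 A B : B \in diam_parts A -> (1 < #|A|)%N.
Proof.
rewrite /diam_parts; case: pickP => [P /and3P[partP P2 eP] _|]; last by rewrite inE.
have /and3P[/eqP <- tivP P0] := partP.
have /card_gt1P[C [D [CP DP CD]]] := P2.
have pt E : E \in P -> exists x, x \in E.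
  by move=> EP; apply/set0Pn; apply: contraNneq P0 => <-.
have [[x xC] [y yD]] := (pt C CP, pt D DP).
apply/card_gt1P; exists x, y; split.
- by apply/bigcupP; exists C.
- by apply/bigcupP; exists D.
- apply: contraNneq CD => xy.
  by rewrite -(def_pblock tivP CP xC) -(def_pblock tivP DP yD) xy.
Qed.

(** By the strong triangle inequality, being closer than the diameter is an equivalence relation on
    [A], so any point of a part can serve as its center. *)
Lemma diam_partE A B x : (1 < #|A|)%N -> B \in diam_parts A -> x \in B ->
  B = [set y in A | mdist x y < diam [set` A]].
Proof.
move=> A1 BP xB; have xA := fintype.subsetP (proper_sub (diam_part_proper A1 BP)) x xB.
have := BP; rewrite (complete_multipartiteE (diam_partsP A1)) => /imsetP[a aA BE].
have rE u v : u \in A -> v \in A -> ~~ diam_edge A u v = (mdist u v < diam [set` A]).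
  by move=> uA vA; rewrite /diam_edge uA vA /= lt_neqAle diam_ub // andbT.
move: xB; rewrite BE inE xA /= rE // => ax.
apply/setP=> y; rewrite !inE; case yA: (y \in A) => //=; rewrite rE //.
apply/idP/idP=> h.
  by apply: le_lt_trans (mdist_ultra x y a) _; rewrite gt_max metric_sym ax.
by apply: le_lt_trans (mdist_ultra a y x) _; rewrite gt_max ax.
Qed.

Lemma diam_part_neq0 A B : B \in diam_parts A -> B != set0.
Proof.
move=> BP; have /and3P[/and3P[_ _ P0] _ _] := diam_partsP (diam_parts_gt1 BP).
by apply: contraNneq P0 => <-.
Qed.

Lemma diam_parts_eq A B C x :
  B \in diam_parts A -> C \in diam_parts A -> x \in B -> x \in C -> B = C.
Proof.
move=> BP CP xB xC; have A1 := diam_parts_gt1 BP.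
by rewrite (diam_partE A1 BP xB) (diam_partE A1 CP xC).
Qed.

Lemma diam_part_ball A B : is_ball A -> B \in diam_parts A -> is_ball B.
Proof.
move=> /is_ballP[_ ballA] BP; have A1 := diam_parts_gt1 BP.
apply/is_ballP; split=> [|x y z xB]; first exact: diam_part_neq0 BP.
rewrite (diam_partE A1 BP xB) !inE => /andP[zA xz] xy.
have xA := fintype.subsetP (proper_sub (diam_part_proper A1 BP)) x xB.
by rewrite (ballA x y z) //= (le_lt_trans xy).
Qed.

(** Take the part [C] of some [x] in [B]. A point [b] of [B] outside [C] would lie at distance
    [diam A] from [x]; the ball [B] would then contain every point of [A]. *)
Lemma sub_diam_part A B : is_ball B -> B \proper A ->
  exists2 C, C \in diam_parts A & B \subset C.
Proof.
move=> /is_ballP[/set0Pn[x xB] ballB] /properP[sBA [a aA aB]].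
have xA := fintype.subsetP sBA x xB.
have A1 : (1 < #|A|)%N.
  by apply/card_gt1P; exists x, a; split=> //; apply: contraNneq aB => <-.
have /and3P[/and3P[/eqP covP _ _] _ _] := diam_partsP A1.
have /bigcupP[C CP xC] : x \in cover (diam_parts A) by rewrite covP.
exists C => //; rewrite (diam_partE A1 CP xC); apply/fintype.subsetP => b bB.
have bA := fintype.subsetP sBA b bB.
rewrite inE bA lt_neqAle diam_ub // andbT; apply: contraNneq aB => xb.
by apply: (ballB x a b) => //; rewrite xb diam_ub.
Qed.

(** * Paths in the representing tree and the balls they lead to *)

Fixpoint node A (p : seq nat) : option {set X} :=
  if p is i :: p' then obind (node^~ p') (onth (enum (diam_parts A)) i)
  else Some A.

Lemma node_cat A p q : node A (p ++ q) = obind (node^~ q) (node A p).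
Proof. by elim: p A => //= i p IH A; case: onth. Qed.

Lemma onth_diam_parts A B i :
  onth (enum (diam_parts A)) i = Some B -> B \in diam_parts A.
Proof. by move=> AB; rewrite -mem_enum; apply/onthP; exists i. Qed.

(** Leaves fit the same formula as internal nodes: on a singleton [diam_parts] takes its default
    value [set0], which gives no children. *)
Lemma children_repr_tree A : A != set0 ->
  children (erase (repr_tree A)) =
  [seq erase (repr_tree B) | B <- enum (diam_parts A)].
Proof.
move=> A0; case: (leqP 2 #|A|) => A1.
  by rewrite repr_tree_node //= -map_comp.
have noparts : diam_parts A = set0.
  by apply/eqP; apply: contraTT A1 => /set0Pn[B /diam_parts_gt1]; rewrite -leqNgt.
have /cards1P[x AE] : #|A| == 1%N by rewrite eqn_leq card_gt0 A0 andbT.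
by rewrite noparts enum_set0 /= AE repr_tree_leaf.
Qed.

Lemma subtree_repr_tree A p : A != set0 ->
  subtree (erase (repr_tree A)) p = omap (fun B => erase (repr_tree B)) (node A p).
Proof.
elim: p A => //= i p IH A A0; rewrite children_repr_tree // onth_map.
case AB: onth => [B|] //=; apply: IH.
exact: diam_part_neq0 (onth_diam_parts AB).
Qed.

Lemma node_ball A B p : is_ball A -> node A p = Some B ->
  is_ball B /\ B \subset A.
Proof.
elim: p A => [|i p IH] A ballA /=; first by case=> <-.
case AC: onth => [C|] //= CB; have CP := onth_diam_parts AC.
have [ballB BC] := IH C (diam_part_ball ballA CP) CB; split=> //.
exact: fintype.subset_trans BC (proper_sub (diam_part_proper (diam_parts_gt1 CP) CP)).
Qed.

(** Descend from [A] into the part containing [B], which [sub_diam_part] provides until [B] itself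
    is reached; cardinality decreases. *)
Lemma ball_node A B : is_ball A -> is_ball B -> B \subset A ->
  exists p, node A p = Some B.
Proof.
have [n] := ubnP #|A|; elim: n A => // n IH A An ballA ballB BA.
have [->|BneA] := eqVneq B A; first by exists [::].
have BpA : B \proper A by rewrite properEneq BneA.
have [C CP BC] := sub_diam_part ballB BpA.
have Cn : (#|C| < n)%N.
  by apply: leq_trans (proper_card (diam_part_proper (diam_parts_gt1 CP) CP)) _.
have [p pB] := IH C Cn (diam_part_ball ballA CP) ballB BC.
have /onthP[i iC] : C \in enum (diam_parts A) by rewrite mem_enum.
by exists (i :: p); rewrite /= iC.
Qed.

(** From inclusion to prefix: the first steps of [p] and [q] lead to parts that share a point of
    [C]. These parts coincide, and so do their indices because [enum] has no duplicates. *)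
Lemma node_prefix A B C p q : is_ball A -> node A p = Some B -> node A q = Some C ->
  prefix p q = (C \subset B).
Proof.
move=> ballA pB qC; apply/idP/idP => [/prefixP[r qE]|].
  move: qC; rewrite qE node_cat pB /=.
  by case/(node_ball (node_ball ballA pB).1).
elim: p A q ballA pB qC => [|i p IH] A q ballA /=; first by rewrite prefix0s.
case AD: onth => [D|] //= DB; have DP := onth_diam_parts AD.
have ballD := diam_part_ball ballA DP.
have [_ BD] := node_ball ballD DB.
(* An empty [q] means [C = A], which would put [A] inside its proper subset [D]. *)
case: q => [[<-] AB|j q] /=.
  have := diam_part_proper (diam_parts_gt1 DP) DP.
  by rewrite properE (fintype.subset_trans AB BD) andbF.
case AE: onth => [E|] //= EC CB; have EP := onth_diam_parts AE.
have [/is_ballP[/set0Pn[x xC] _] CE] := node_ball (diam_part_ball ballA EP) EC.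
have DE : D = E.
  apply: (diam_parts_eq (x := x) DP EP); last exact: fintype.subsetP CE x xC.
  by apply: (fintype.subsetP BD); apply: (fintype.subsetP CB).
apply/andP; split; last by apply: IH ballD DB _ CB; rewrite DE.
have iD : (i < size (enum (diam_parts A)))%N by rewrite -onthTE AD.
apply/eqP; apply: (onth_inj (enum (diam_parts A))).
- exact: enum_uniq.
- by rewrite gtn_min iD orbT.
- by rewrite AD AE DE.
Qed.

Lemma vertex_ball : (0 < #|X|)%N ->
  exists (b : vertex (erase (repr_tree [set: X])) -> {set X}) v,
    [/\ forall u, is_ball (b u), forall A, is_ball A -> b (v A) = A,
        forall u, v (b u) = u &
        forall u w, prefix (sval u) (sval w) = (b w \subset b u)].
Proof.
move=> X0; have ballT := is_ballT X0; have T0 := (is_ballP _ ballT).1.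
set t := erase _.
have vP p : isSome (subtree t p) = isSome (node [set: X] p).
  by rewrite subtree_repr_tree //; case: node.
have bP (u : vertex t) : exists A, node [set: X] (sval u) = Some A.
  by case: u => p /=; rewrite vP; case: node => // A _; exists A.
have [b bE] := choice bP.
have wP (A : {set X}) : exists u : vertex t, is_ball A -> node [set: X] (sval u) = Some A.
  (* The root is an arbitrary value for sets that are not balls, so that [choice] yields a total
     [v]. *)
  case ballA : (is_ball A); last by exists (Defs.root t).
  have [p pA] := ball_node ballT ballA (subsetT A).
  have pv : isSome (subtree t p) by rewrite vP pA.
  by exists (exist _ p pv).
have [v vE] := choice wP.
have b_ball u : is_ball (b u) := (node_ball ballT (bE u)).1.
have b_pre u w : prefix (sval u) (sval w) = (b w \subset b u).
  exact: node_prefix ballT (bE u) (bE w).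
have vK A : is_ball A -> b (v A) = A.
  by move=> /vE; rewrite bE => -[->].
exists b, v; split=> // u; apply: val_inj => /=.
(* The vertices [v (b u)] and [u] carry the same ball, so each is a prefix of the other. *)
by apply: prefix_antisym; rewrite b_pre vK.
Qed.

End Balls.

(** * Isomorphisms of ball posets and ball-preserving bijections *)

Section BallOrder.
Context {R : realType}.

(** Only one half of a poset isomorphism; the full notion pairs it with [ball_iso G F]. Both maps
    are total on sets, with unconstrained values off the balls. *)
Definition ball_iso (X Y : finUltrametricType R)
    (F : {set X} -> {set Y}) (G : {set Y} -> {set X}) : Prop :=
  [/\ forall A, is_ball A -> is_ball (F A), forall A, is_ball A -> G (F A) = A &
      forall A B, is_ball A -> is_ball B -> (F A \subset F B) = (A \subset B)].

(** Singletons are the minimal balls: for [y] in [F [set x]], the nonempty ball [G [set y]] lies in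
    [[set x]], so equals it. *)
Lemma ball_iso_set1 (X Y : finUltrametricType R) F G :
  @ball_iso X Y F G -> @ball_iso Y X G F -> forall x, exists y, F [set x] = [set y].
Proof.
move=> [F_ball FK F_sub] [G_ball GK G_sub] x.
have ballx := is_ball_set1 x.
have /is_ballP[/set0Pn[y yF] _] := F_ball _ ballx.
have bally := is_ball_set1 y; exists y.
have : G [set y] \subset [set x].
  by rewrite -(FK [set x]) // G_sub ?F_ball // sub1set.
rewrite subset1 => /orP[/eqP <-|/eqP G0]; first by rewrite GK.
by have /is_ballP[] := G_ball _ bally; rewrite G0 eqxx.
Qed.

Lemma ball_iso_preserving (X Y : finUltrametricType R) :
  (exists F G, @ball_iso X Y F G /\ @ball_iso Y X G F) <->
  exists Phi : X -> Y, bijective Phi /\ ball_preserving Phi.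
Proof.
have ballsW (Z : finUltrametricType R) (W : set Z) :
  exists A : {set Z}, W = [set` A]%classic.
  exists [set x | `[< W x >]]; apply/seteqP.
  by split=> x /=; rewrite inE => /asboolP.
split=> [[F [G [FG GF]]]|[Phi [[Psi PhiK PsiK] [Phi_im Phi_pre]]]].
  have [Phi FE] := choice (ball_iso_set1 FG GF).
  have [Psi GE] := choice (ball_iso_set1 GF FG).
  have [F_ball FK F_sub] := FG; have [G_ball GK G_sub] := GF.
  have PhiK : cancel Phi Psi.
    by move=> x; apply: set1_inj; rewrite -GE -FE FK // is_ball_set1.
  have PsiK : cancel Psi Phi.
    by move=> x; apply: set1_inj; rewrite -FE -GE GK // is_ball_set1.
  (* Membership is inclusion of a singleton ball, so on balls [F] is the image under [Phi] and [G]
     the preimage. *)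
  have inF A x : is_ball A -> (Phi x \in F A) = (x \in A).
    by move=> ballA; rewrite -sub1set -FE F_sub ?is_ball_set1 // sub1set.
  exists Phi; split; first by exists Psi.
  split=> W; have [A ->] := ballsW _ W => /ballsP ballA.
    suff -> : (Phi @` [set` A])%classic = [set` F A]%classic by apply/ballsP/F_ball.
    apply/seteqP; split=> [_ [x xA <-]|y yF] /=; first by rewrite inF.
    by exists (Psi y); rewrite ?PsiK //= -inF // PsiK.
  suff -> : (Phi @^-1` [set` A])%classic = [set` G A]%classic by apply/ballsP/G_ball.
  by apply/seteqP; split=> x /=; rewrite -(inF (G A)) ?G_ball // GK.
have im_ball (A : {set X}) : is_ball A -> is_ball (Phi @: A).
  move=> /ballsP/Phi_im; set W := (W in balls Y W).
  suff -> : W = [set` Phi @: A]%classic by move/ballsP.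
  apply/seteqP; split=> [_ [x xA <-]|y /imsetP[x xA ->]]; last by exists x.
  exact: imset_f.
have imK (A : {set X}) : Psi @: (Phi @: A) = A.
  by rewrite -imset_comp (eq_imset (g := id)) ?imset_id.
have imV (A : {set Y}) : Phi @: (Psi @: A) = A.
  by rewrite -imset_comp (eq_imset (g := id)) ?imset_id.
(* The image under [Psi] is the preimage under [Phi]. *)
have pre_ball (A : {set Y}) : is_ball A -> is_ball (Psi @: A).
  move=> /ballsP/Phi_pre; set W := (W in balls X W).
  suff -> : W = [set` Psi @: A]%classic by move/ballsP.
  apply/seteqP; split=> [x xA|x /imsetP[y yA ->]]; rewrite /W /= ?PsiK //.
  by rewrite -(PhiK x); apply: imset_f.
exists (fun A : {set X} => Phi @: A), (fun B : {set Y} => Psi @: B).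
split; split=> // A B _ _; apply/idP/idP; try exact: imsetS.
  by move/(imsetS Psi); rewrite !imK.
by move/(imsetS Phi); rewrite !imV.
Qed.

(** Vertex maps and ball maps are conjugated through [vertex_ball]. Prefix becomes reverse inclusion
    on both sides, so the two reversals cancel. *)
Lemma tree_iso_ball_iso (X Y : finUltrametricType R) :
  (0 < #|X|)%N -> (0 < #|Y|)%N ->
  tree_iso (erase (repr_tree [set: X])) (erase (repr_tree [set: Y])) <->
  exists F G, @ball_iso X Y F G /\ @ball_iso Y X G F.
Proof.
move=> X0 Y0; have [b [v [b_ball vK bK b_pre]]] := vertex_ball X0.
have [c [w [c_ball wK cK c_pre]]] := vertex_ball Y0.
rewrite tree_isoP; split=> [[f [[g fK gK] f_pre]]|[F [G [FG GF]]]].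
  exists (fun A => c (f (v A))), (fun A => b (g (w A))).
  split; split=> // A.
  - by move=> ballA; rewrite cK fK vK.
  - by move=> B ballA ballB; rewrite -c_pre f_pre b_pre !vK.
  - by move=> ballA; rewrite bK gK wK.
  - by move=> B ballA ballB; rewrite -b_pre -f_pre !gK c_pre !wK.
have [F_ball FK F_sub] := FG; have [G_ball GK G_sub] := GF.
exists (fun u => w (F (b u))); split.
  exists (fun u => v (G (c u))) => u.
    by rewrite wK ?F_ball // FK // bK.
  by rewrite vK ?G_ball // GK // cK.
by move=> u u'; rewrite c_pre !wK ?F_ball // F_sub // b_pre.
Qed.

End BallOrder.

Theorem mainTheorem1 (R : realType) (X Y : finUltrametricType R)
    (X_nonempty : (0 < #|X|)%N) (Y_nonempty : (0 < #|Y|)%N) :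
  tree_iso (erase (repr_tree [set: X])) (erase (repr_tree [set: Y])) <->
  exists Phi : X -> Y, bijective Phi /\ ball_preserving Phi.
Proof.
by rewrite tree_iso_ball_iso //; apply: ball_iso_preserving.
Qed.
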